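(* Let $\psi$ be a quasiperiodic flow on $T^2$ (generated by a constant vector field). If $\psi$ is transcendental, then $M_\psi=\{1,-1\}$.
   Context: $T^2=\mathbb{R}^2/\mathbb{Z}^2$ is the $2$-torus with global coordinates $(\theta_1,\theta_2)$. For a smooth ($C^\infty$) flow $\psi:\mathbb{R}\times T^2\to T^2$, its generating vector field is $X_\psi(p)=\frac{d}{dt}\psi(t,p)|_{t=0}$. A constant vector field is one of the form $a_1\,\partial/\partial\theta_1+a_2\,\partial/\partial\theta_2$ with $a_1,a_2\in\mathbb{R}$. A flow generated by a constant vector field is quasiperiodic if the components $a_1,a_2$ are linearly independent over $\mathbb{Q}$. Generalized symmetry group: $S_\psi$ is the group of all $R\in\mathrm{Diff}(T^2)$ (smooth diffeomorphisms) for which there is $\alpha\in\mathbb{R}^*=\mathbb{R}\setminus\{0\}$ with $R_*X_\psi=\alpha X_\psi$, where $R_*X_\psi=\mathbf{T}R\,X_\psi\,R^{-1}$ is the push-forward and $\mathbf{T}R$ is the derivative map of $R$. The unique such $\alpha$ is the multiplier $\rho_\psi(R)$, and the multiplier group is $M_\psi=\rho_\psi(S_\psi)\subset\mathbb{R}^*$. A real quadratic number field is a subfield $F$ of $\mathbb{R}$ of degree $2$ over $\mathbb{Q}$. A quasiperiodic flow $\psi$ on $T^2$ generated by $X_\psi=a_1\,\partial/\partial\theta_1+a_2\,\partial/\partial\theta_2$ is called $F$-algebraic if there is $\vartheta\in\mathbb{R}^*$ such that $\{\vartheta a_1,\vartheta a_2\}$ is a $\mathbb{Q}$-basis of $F$.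 A quasiperiodic flow on $T^2$ is called transcendental if it is not $F$-algebraic for any real quadratic number field $F$. *)

(* Defs.v *)
From HB Require Import structures.
From mathcomp Require Import all_boot all_order all_algebra.
From mathcomp Require Import all_classical all_reals all_analysis.
Import Order.TTheory GRing.Theory Num.Theory.
Import numFieldNormedType.Exports.

Set Implicit Arguments.
Unset Strict Implicit.
Unset Printing Implicit Defensive.

Local Open Scope classical_set_scope.
Local Open Scope ring_scope.

(* In finite dimension, asking that all directional derivatives be C^n is the
   same as asking it of the total derivative. *)
Fixpoint Ck (R : realType) (V W : normedModType R) (n : nat) (U : set V)
    (f : V -> W) : Prop :=
  match n with
  | 0 => forall x, U x -> {for x, continuous f}
  | n'.+1 => (forall x, U x -> differentiable f x) /\
             (forall v, Ck n' U ('D_v f))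
  end.

Definition smooth_near (R : realType) (V W : normedModType R) (x : V)
    (f : V -> W) : Prop :=
  exists U : set V, [/\ open U, U x & forall n, Ck n U f].

Definition Z2 (R : realType) : {pred 'rV[R]_2} := mxOver Num.int.
Arguments Z2 : clear implicits.

Lemma Z2_zmod_closed (R : realType) : zmod_closed (Z2 R).
Proof.
split=> [|x y /mxOverP xZ /mxOverP yZ]; apply/mxOverP => i j.
  by rewrite mxE rpred0.
by rewrite !mxE rpredB.
Qed.

HB.instance Definition _ (R : realType) :=
  GRing.isZmodClosed.Build 'rV[R]_2 (Z2 R) (@Z2_zmod_closed R).

Definition torus (R : realType) := Quotient.quot (Z2 R).
Arguments torus : clear implicits.

HB.instance Definition _ (R : realType) := GRing.Zmodule.on (torus R).

Definition torus_pi (R : realType) (x : 'rV[R]_2) : torus R :=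
  (\pi_(Quotient.quot (Z2 R)) x)%qT.

(* The charts of the torus are the local inverses of [torus_pi], so the
   coordinate expression near [x] of a map [f] into the torus is a local lift
   of [f]; two such lifts differ near [x] by an element of Z^2. *)
Definition local_lift (R : realType) (V : normedModType R) (f : V -> torus R)
    (x : V) (F : V -> 'rV[R]_2) : Prop :=
  {for x, continuous F} /\ \forall y \near x, torus_pi (F y) = f y.

Definition smooth_to_torus (R : realType) (V : normedModType R)
    (f : V -> torus R) : Prop :=
  forall x, exists2 F, local_lift f x F & smooth_near x F.

(* Every tangent space of the torus is identified with R^2 by means of the
   frame d/dtheta_1, d/dtheta_2. *)
Definition torus_derive (R : realType) (V : normedModType R)
    (f : V -> torus R) (x v : V) : 'rV[R]_2 :=
  xget 0 [set w | exists2 F, local_lift f x F & is_derive x v F w].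

Definition smooth_torus_map (R : realType) (f : torus R -> torus R) : Prop :=
  smooth_to_torus (f \o @torus_pi R).

(* Independent of the representative of [p], the translations by Z^2 having
   the identity as their derivative. *)
Definition tangent_map (R : realType) (f : torus R -> torus R) (p : torus R)
    (v : 'rV[R]_2) : 'rV[R]_2 :=
  torus_derive (f \o @torus_pi R) (repr p) v.

Record diffeo (R : realType) := Diffeo {
  dfun :> torus R -> torus R;
  dinv : torus R -> torus R;
  dfunK : cancel dfun dinv;
  dinvK : cancel dinv dfun;
  dfun_smooth : smooth_torus_map dfun;
  dinv_smooth : smooth_torus_map dinv }.

Definition vector_field (R : realType) := torus R -> 'rV[R]_2.

Definition pushforward (R : realType) (f : diffeo R) (X : vector_field R) :
    vector_field R :=
  fun q => tangent_map f (dinv f q) (X (dinv f q)).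

Definition smooth_flow (R : realType) (psi : R -> torus R -> torus R) : Prop :=
  [/\ smooth_to_torus
        (fun z : (R^o * 'rV[R]_2)%type => psi z.1 (torus_pi z.2)),
      forall p, psi 0 p = p
    & forall s t p, psi (s + t) p = psi s (psi t p)].

Definition generator (R : realType) (psi : R -> torus R -> torus R) :
    vector_field R :=
  fun p => torus_derive (fun t : R^o => psi t p) 0 1.

Definition generated_by_constant (R : realType)
    (psi : R -> torus R -> torus R) (a : 'rV[R]_2) : Prop :=
  forall p, generator psi p = a.

Definition rationally_independent (R : realType) (a b : R) : Prop :=
  forall r s : rat, ratr r * a + ratr s * b = 0 -> r = 0 /\ s = 0.

Definition quasiperiodic_flow (R : realType)
    (psi : R -> torus R -> torus R) : Prop :=
  smooth_flow psi /\
  exists a : 'rV[R]_2, generated_by_constant psi a /\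
                       rationally_independent (a 0 0) (a 0 1).

Definition is_multiplier (R : realType) (psi : R -> torus R -> torus R)
    (f : diffeo R) (alpha : R) : Prop :=
  alpha != 0 /\
  forall p, pushforward f (generator psi) p = alpha *: generator psi p.

Definition symmetry_group (R : realType) (psi : R -> torus R -> torus R) :
    set (diffeo R) :=
  [set f | exists alpha, is_multiplier psi f alpha].

Definition multiplier (R : realType) (psi : R -> torus R -> torus R)
    (f : diffeo R) : R :=
  xget 0 [set alpha | is_multiplier psi f alpha].

Definition multiplier_group (R : realType)
    (psi : R -> torus R -> torus R) : set R :=
  multiplier psi @` symmetry_group psi.

Definition rational_basis (R : realType) (F : {pred R}) (a b : R) : Prop :=
  [/\ a \in F, b \in F, rationally_independent a b
    & forall x, x \in F -> exists r s : rat, x = ratr r * a + ratr s * b].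

Definition real_quadratic_field (R : realType) (F : {pred R}) : Prop :=
  divring_closed F /\ exists a b, rational_basis F a b.

Definition algebraic_flow (R : realType) (F : {pred R})
    (psi : R -> torus R -> torus R) : Prop :=
  quasiperiodic_flow psi /\
  exists a : 'rV[R]_2, generated_by_constant psi a /\
    exists2 theta : R, theta != 0
      & rational_basis F (theta * a 0 0) (theta * a 0 1).

Definition transcendental_flow (R : realType)
    (psi : R -> torus R -> torus R) : Prop :=
  quasiperiodic_flow psi /\
  forall F : {pred R}, real_quadratic_field F -> ~ algebraic_flow F psi.

(* Main.v *)
Require Import Defs.
From mathcomp Require Import all_boot all_order all_algebra.
From mathcomp Require Import all_classical all_reals all_analysis.
From mathcomp Require Import ring lra.
Import Order.TTheory GRing.Theory Num.Theory numFieldNormedType.Exports.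

Set Implicit Arguments.
Unset Strict Implicit.
Unset Printing Implicit Defensive.

Local Open Scope classical_set_scope.
Local Open Scope ring_scope.

(* Let [f] be a diffeomorphism of multiplier [alpha] and let the flow be
   generated by the constant field [a]. Integrating the tangent condition gives
   [f (p + t a) = f p + t alpha a]. Lifting [f] to the plane as the sum of an
   integer matrix [B] and a periodic, hence bounded, map, and comparing the
   growth in [t] of both sides, yields [a B = alpha a]. The same argument for
   the inverse of [f] yields [a B' = alpha^-1 a]. If [B] or [B'] is not diagonal
   then the ratio of the components of [a] is a quadratic irrational and the
   flow is algebraic; otherwise [alpha] and [alpha^-1] are integers. *)

(** * The projection to the torus and the integer lattice *)

Lemma subr_swap (V : zmodType) (a b c d : V) : a - b = c - d -> a - c = b - d.
Proof.
move/eqP; rewrite subr_eq => /eqP ->.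
by rewrite [c - d]addrC addrAC addrK addrC.
Qed.

Lemma torus_piD (R : realType) (x y : 'rV[R]_2) :
  torus_pi (x + y) = torus_pi x + torus_pi y.
Proof. by rewrite /torus_pi raddfD. Qed.

Lemma torus_piN (R : realType) (x : 'rV[R]_2) : torus_pi (- x) = - torus_pi x.
Proof. by rewrite /torus_pi raddfN. Qed.

Lemma torus_piB (R : realType) (x y : 'rV[R]_2) :
  torus_pi (x - y) = torus_pi x - torus_pi y.
Proof. by rewrite torus_piD torus_piN. Qed.

Lemma torus_pi_eq0 (R : realType) (x : 'rV[R]_2) :
  (torus_pi x == 0) = (x \in Z2 R).
Proof.
have -> : 0 = torus_pi 0 :> torus R by rewrite /torus_pi raddf0.
by rewrite /torus_pi -Quotient.idealrBE subr0.
Qed.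

Lemma torus_pi_eq (R : realType) (x y : 'rV[R]_2) :
  (torus_pi x == torus_pi y) = (x - y \in Z2 R).
Proof. by rewrite -subr_eq0 -torus_piB torus_pi_eq0. Qed.

Lemma torus_piK (R : realType) (p : torus R) : torus_pi (repr p) = p.
Proof. exact: reprK. Qed.

Lemma le_mx_norm_coord (R : realType) n (x : 'rV[R]_n) j : `|x 0 j| <= `|x|.
Proof.
rewrite [leRHS]mx_normrE.
by apply: le_trans (le_bigmax _ _ (0, j)).
Qed.

Lemma mx_norm_le (R : realType) n (x : 'rV[R]_n) c :
  0 <= c -> (forall j, `|x 0 j| <= c) -> `|x| <= c.
Proof.
move=> c0 xc; rewrite [leLHS]mx_normrE; apply: bigmax_le => // -[i j] _ /=.
by rewrite ord1.
Qed.

Lemma Z2_norm_lt1 (R : realType) (x : 'rV[R]_2) :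
  x \in Z2 R -> `|x| < 1 -> x = 0.
Proof.
move=> /mxOverP xZ x1; apply/rowP => j; rewrite mxE.
have := le_lt_trans (le_mx_norm_coord x j) x1.
by apply: contraTeq => xj0; rewrite -leNgt norm_intr_ge1.
Qed.

(** A nonzero lattice vector has sup norm at least 1. This is the tool that turns equalities on the
    torus into equalities in the plane. *)
Lemma torus_pi_inj_lt1 (R : realType) (x y : 'rV[R]_2) :
  torus_pi x = torus_pi y -> `|x| + `|y| < 1 -> x = y.
Proof.
move=> /eqP; rewrite torus_pi_eq => xyZ xy1; apply/eqP; rewrite -subr_eq0.
by apply/eqP/Z2_norm_lt1 => //; apply: le_lt_trans xy1; exact: ler_normB.
Qed.

Lemma rV2_decomp (R : realType) (x : 'rV[R]_2) :
  exists n r : 'rV[R]_2, [/\ x = n + r, n \in Z2 R & `|r| <= 1].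
Proof.
pose n : 'rV[R]_2 := \row_j (Num.floor (x 0 j))%:~R.
exists n, (x - n); split; first by rewrite addrC subrK.
  by apply/mxOverP => i j; rewrite mxE; apply/intrP; eexists.
apply: mx_norm_le => // j; rewrite !mxE.
have := floor_le (x 0 j); have := floorD1_gt (x 0 j).
rewrite intrD => h1 h2; rewrite ger0_norm; lra.
Qed.

(** * Lifting periodic torus-valued maps to the plane *)

(** Uniform continuity of [g]: local lifts give it near each point, compactness on a square, and
    periodicity on the whole plane. *)
Lemma periodic_lift_uniform (R : realType) (g : 'rV[R]_2 -> torus R) (c : R) :
  0 < c -> (forall x, exists F, local_lift g x F) ->
  (forall x n, n \in Z2 R -> g (x + n) = g x) ->
  exists2 delta, 0 < delta & forall x y, `|x - y| < delta ->
    exists2 d, `|d| < c & torus_pi d = g y - g x.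
Proof.
move=> c0 gL gper.
pose P (delta : R) (x : 'rV[R]_2) := forall y, `|x - y| < delta ->
    exists2 d, `|d| < c & torus_pi d = g y - g x.
have cK : compact [set v : 'rV[R]_2 | forall i, v ord0 i \in `[-1, 1]].
  exact: rV_compact (fun=> @segment_compact R (-1) 1).
have nP : \forall d \near 0^'+,
    [set v : 'rV[R]_2 | forall i, v ord0 i \in `[-1, 1]] `<=` P d.
  move/compact_near_coveringP: cK; apply => x _.
  have [F [Fc Fg]] := gL x.
  have c20 : 0 < c / 2 by rewrite divr_gt0.
  have /nbhs_normP[r /= r0 Fr] :
      \forall y \near x, `|F x - F y| < c / 2 /\ torus_pi (F y) = g y.
    near=> y; split; last by near: y.
    by near: y; move/cvgrPdist_lt: Fc; apply.
  (* With [z] within [r / 2] of [x] and [y] within [r / 2] of [z], both lie in the ball where the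
     single lift [F] serves. *)
  exists (ball x (r / 2), [set d : R | d < r / 2]).
    split; first by apply: nbhsx_ballx; rewrite divr_gt0.
    by apply: nbhs_right_lt; rewrite divr_gt0.
  move=> [z d] /= [xz dr] y zy.
  have xzr : `|x - z| < r / 2 by move: xz; rewrite -ball_normE.
  have xyr : `|x - y| < r / 2 + r / 2.
    rewrite -(subrKA z); apply: le_lt_trans (ler_normD _ _) _.
    by apply: ltrD => //; exact: lt_trans zy dr.
  have [Fxz gz] : `|F x - F z| < c / 2 /\ torus_pi (F z) = g z.
    by apply: Fr => /=; apply: lt_trans xzr _; lra.
  have [Fxy gy] : `|F x - F y| < c / 2 /\ torus_pi (F y) = g y.
    by apply: Fr => /=; apply: lt_le_trans xyr _; lra.
  exists (F y - F z); last by rewrite torus_piB gy gz.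
  rewrite -(subrKA (F x)) (splitr c); apply: le_lt_trans (ler_normD _ _) _.
  by apply: ltrD => //; rewrite distrC.
have [delta [delta0 dP]] : exists delta : R, 0 < delta /\
    [set v : 'rV[R]_2 | forall i, v ord0 i \in `[-1, 1]] `<=` P delta.
  near (0 : R)^'+ => delta; exists delta.
  by split; near: delta; [exact: nbhs_right_gt|exact: nP].
exists delta => // x y xy.
have [n [r [xE nZ r1]]] := rV2_decomp x.
have [||d dc dE] := dP r _ (y - n).
- move=> i; rewrite in_itv /= -ler_norml.
  exact: le_trans (le_mx_norm_coord _ _) r1.
- by rewrite opprB addrA [r + n]addrC -xE.
exists d => //; rewrite dE -(gper r n nZ) -(gper (y - n) n nZ) subrK.
by rewrite [r + n]addrC -xE.
Unshelve. all: by end_near. Qed.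

(** There is at most one such [d], since two of them differ by a lattice vector of norm below 1. *)
Definition small_rep (R : realType) (p : torus R) : 'rV[R]_2 :=
  xget 0 [set d | `|d| < 1 / 4 /\ torus_pi d = p].

Section Lifting.
Variables (R : realType) (g : 'rV[R]_2 -> torus R) (delta : R).
Hypothesis delta_gt0 : 0 < delta.
Hypothesis gdelta : forall x y, `|x - y| < delta ->
  exists2 d, `|d| < 1 / 4 & torus_pi d = g y - g x.

Let D x y := small_rep (g y - g x).

Let DP x y : `|x - y| < delta ->
  `|D x y| < 1 / 4 /\ torus_pi (D x y) = g y - g x.
Proof.
move=> /gdelta[d d4 dE]; rewrite /D /small_rep.
by case: xgetP => [e _ //|/(_ d)]; case.
Qed.

(** Both sums project to [g z - g x]. Four terms of norm below 1/4 total less than 1, which is the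
    reason for the bound 1/4. *)
Let D_square x y z w : `|x - y| < delta -> `|y - z| < delta ->
  `|x - w| < delta -> `|w - z| < delta -> D x y + D y z = D x w + D w z.
Proof.
move=> /DP[n1 e1] /DP[n2 e2] /DP[n3 e3] /DP[n4 e4]; apply: torus_pi_inj_lt1.
  rewrite !torus_piD e1 e2 e3 e4.
  by rewrite [g y - _ + _]addrC [g w - _ + _]addrC !addrA !subrK.
have := ler_normD (D x y) (D y z); have := ler_normD (D x w) (D w z); lra.
Qed.

(* Lift radially: sum the small differences of [g] along a subdivision of the
   segment from 0 to [x]; neighbouring segments bound a strip of small squares
   along which the sums telescope. *)
Lemma lift_on_ball r : exists F : 'rV[R]_2 -> 'rV[R]_2,
  forall x y, `|x| < r -> `|y| < r -> `|x - y| < delta ->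
    `|F y - F x| < 1 / 4 /\ torus_pi (F y - F x) = g y - g x.
Proof.
(* Fine enough for consecutive subdivision points of a vector of norm below [r] to be less than
   [delta] apart. *)
pose N := (Num.truncn (r / delta)).+1.
have N0 : 0 < N%:R :> R by rewrite ltr0n.
have rN : r / N%:R < delta.
  by rewrite ltr_pdivrMr // -ltr_pdivrMl // mulrC /N; exact: truncnS_gt.
pose pt (x : 'rV[R]_2) k := (k%:R / N%:R) *: x.
exists (fun x => \sum_(k < N) D (pt x k) (pt x k.+1)) => x y xr yr xy.
have step z k : `|z| < r -> `|pt z k - pt z k.+1| < delta.
  move=> zr; rewrite -scalerBl -mulrBl -natr1 opprD addrA subrr add0r mulN1r.
  rewrite normrZ normrN ger0_norm ?invr_ge0 ?ltW // mulrC.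
  by apply: le_lt_trans rN; rewrite ler_pM2r ?invr_gt0 // ltW.
have across k : (k <= N)%N -> `|pt x k - pt y k| < delta.
  move=> kN; rewrite -scalerBr normrZ ger0_norm ?divr_ge0 ?ler0n //.
  apply: le_lt_trans xy; rewrite ler_piMl // ler_pdivrMr // mul1r ler_nat.
  exact: kN.
have tele n : (n <= N)%N -> \sum_(k < n) D (pt y k) (pt y k.+1) -
    \sum_(k < n) D (pt x k) (pt x k.+1) = D (pt x n) (pt y n) - D 0 0.
  elim: n => [_|n IHn nN].
    by rewrite !big_ord0 subrr /pt !mul0r !scale0r subrr.
  have sq := D_square (across _ (ltnW nN)) (step y n yr)
                      (step x n xr) (across _ nN).
  rewrite !big_ord_recr /= opprD addrACA IHn ?(ltnW nN) //.
  by rewrite addrACA sq [- _ - _]addrC addrACA subrr add0r.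
have ptN z : pt z N = z by rewrite /pt divff ?scale1r // gt_eqF.
have D00 : D 0 0 = 0.
  have [|n0 e0] := @DP 0 0; first by rewrite subrr normr0.
  apply: Z2_norm_lt1; last by lra.
  by rewrite -torus_pi_eq0 e0 subrr.
by rewrite tele // !ptN D00 subr0; exact: DP.
Qed.

(** Induction along [M] steps of length [1 / M < eta]. Since [P] may depend on the step number, this
    yields both constancy and bounds that grow by a fixed amount per step. *)
Lemma unit_interval_chain (P : nat -> R -> Prop) (eta : R) (M : nat) :
  1 < M%:R * eta -> P 0%N 0 ->
  (forall n s t, 0 <= s <= 1 -> 0 <= t <= 1 -> `|s - t| < eta ->
     P n s -> P n.+1 t) ->
  P M 1.
Proof.
case: M => [|M]; first by rewrite mul0r ltr10.
move=> Meta P0 PS; have M0 : 0 < M.+1%:R :> R by rewrite ltr0n.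
have I01 k : (k <= M.+1)%N -> 0 <= (k%:R / M.+1%:R : R) <= 1.
  by move=> kM; rewrite divr_ge0 ?ler0n //= ler_pdivrMr // mul1r ler_nat.
suff Pn n : (n <= M.+1)%N -> P n (n%:R / M.+1%:R).
  by have := Pn _ (leqnn _); rewrite divff // gt_eqF.
elim: n => [_|n IHn nM]; first by rewrite mul0r.
apply: PS (IHn (ltnW nM)); [exact/I01/ltnW|exact: I01|].
rewrite -mulrBl -natr1 opprD addrA subrr add0r mulN1r normrN.
by rewrite ger0_norm ?invr_ge0 ?ltW // -div1r ltr_pdivrMr // mulrC.
Qed.

Lemma locally_constant_01 (T : Type) (K : R -> T) (eta : R) :
  0 < eta ->
  (forall s t, 0 <= s <= 1 -> 0 <= t <= 1 -> `|s - t| < eta -> K t = K s) ->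
  K 1 = K 0.
Proof.
move=> eta0 Keta.
apply: (@unit_interval_chain (fun=> fun s => K s = K 0) eta
          (Num.truncn (1 / eta)).+1) => // [|n s t s01 t01 st <-].
  by rewrite -ltr_pdivrMr //; exact: truncnS_gt.
exact: Keta.
Qed.

Lemma locally_constant_ray (T : Type) (K : 'rV[R]_2 -> T) (x : 'rV[R]_2) :
  (forall y z, `|y| <= `|x| -> `|z| <= `|x| -> `|y - z| < delta -> K z = K y) ->
  K x = K 0.
Proof.
move=> Kdelta; rewrite -[x in LHS]scale1r -[0 in RHS](scale0r x).
(* Dividing by [|x| + 1] instead of [|x|] covers [x = 0] as well. *)
have x1 : 0 < `|x| + 1 by rewrite ltr_pwDr.
apply: (@locally_constant_01 _ (fun s => K (s *: x)) (delta / (`|x| + 1))).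
  by rewrite divr_gt0.
have inr s : 0 <= s <= 1 -> `|s *: x| <= `|x|.
  by case/andP=> s0 s1; rewrite normrZ ger0_norm // ler_piMl.
move=> s t /inr sr /inr tr; rewrite ltr_pdivlMr // => st; apply: Kdelta => //.
rewrite -scalerBl normrZ; apply: le_lt_trans st.
by rewrite ler_wpM2l // lerDl.
Qed.

(** Increments of [F] and [G] between nearby points are small and have the same projection, so they
    coincide, and [F - G] is constant along rays. *)
Lemma lifts_differ_by_cst r (F G : 'rV[R]_2 -> 'rV[R]_2) :
  (forall x y, `|x| < r -> `|y| < r -> `|x - y| < delta ->
    `|F y - F x| < 1 / 4 /\ torus_pi (F y - F x) = g y - g x) ->
  (forall x y, `|x| < r -> `|y| < r -> `|x - y| < delta ->
    `|G y - G x| < 1 / 4 /\ torus_pi (G y - G x) = g y - g x) ->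
  forall x, `|x| < r -> F x - F 0 = G x - G 0.
Proof.
move=> FP GP x xr; apply: subr_swap.
apply: (@locally_constant_ray _ (fun x => F x - G x)) => y z yx zx yz.
have [yr zr] : `|y| < r /\ `|z| < r by split; exact: le_lt_trans xr.
have [F4 FE] := FP _ _ yr zr yz; have [G4 GE] := GP _ _ yr zr yz.
apply: subr_swap; apply: torus_pi_inj_lt1; first by rewrite FE GE.
by lra.
Qed.

(** Lifts on balls of all radii, normalised to vanish at 0, agree on overlaps and glue together. *)
Lemma global_lift : exists F : 'rV[R]_2 -> 'rV[R]_2,
  [/\ F 0 = 0, forall x, torus_pi (F x) = g x - g 0 &
    forall x y, `|x - y| < delta -> `|F y - F x| < 1 / 4].
Proof.
have [Fk FkP] := choice lift_on_ball.
(* The ball depends on [x]; by [FE] every larger one gives the same value. *)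
pose F x := Fk (`|x| + 1) x - Fk (`|x| + 1) 0.
have FE r x : `|x| + 1 <= r -> F x = Fk r x - Fk r 0.
  move=> xr; apply: (@lifts_differ_by_cst (`|x| + 1)) => [|y z yx zx|].
  - exact: FkP.
  - by apply: FkP; [exact: lt_le_trans yx _|exact: lt_le_trans zx _].
  - by rewrite ltrDl.
have F0 : F 0 = 0 by rewrite /F subrr.
have FP x y : `|x - y| < delta ->
    `|F y - F x| < 1 / 4 /\ torus_pi (F y - F x) = g y - g x.
  move=> xy; pose r := `|x| + `|y| + 1.
  rewrite (FE r x) ?(FE r y) ?lerD2r ?lerDl ?lerDr //.
  rewrite opprB addrA subrK; apply: FkP => //.
    by rewrite ltr_pwDr // lerDl.
  by rewrite ltr_pwDr // lerDr.
exists F; split=> [//|x|x y xy]; last by have [] := FP x y xy.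
have := @locally_constant_ray _ (fun x => torus_pi (F x) - g x) x.
rewrite F0 /torus_pi raddf0 sub0r => /(_ _)/eqP; rewrite subr_eq addrC => /(_ _)/eqP; apply.
move=> y z _ _ /FP[_]; rewrite torus_piB; exact: subr_swap.
Qed.

End Lifting.

(** * The integer matrix of an equivariant torus map *)

(** A lift [F] of [h] minus its value at 0 equals [B] on the lattice, stays within bounded distance
    of [B] elsewhere and is linear along [a]. So [t *: (b - a *m B)] is bounded in [t], which forces
    [b = a *m B]. *)
Lemma equivariant_map_matrix (R : realType) (h : torus R -> torus R)
    (a b : 'rV[R]_2) :
  (forall x, exists F, local_lift (h \o @torus_pi R) x F) ->
  (forall p t, h (p + torus_pi (t *: a)) = h p + torus_pi (t *: b)) ->
  exists2 B : 'M[R]_2, B \is a mxOver Num.int & a *m B = b.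
Proof.
move=> hL ha; pose g := h \o @torus_pi R.
have gper x n : n \in Z2 R -> g (x + n) = g x.
  by rewrite -torus_pi_eq0 /g /= torus_piD => /eqP ->; rewrite addr0.
have {}hL : forall x, exists F, local_lift g x F by [].
have c0 : 0 < 1 / 4 :> R by lra.
have [delta delta0 gdelta] := periodic_lift_uniform c0 hL gper.
have [F [F0 piF Fsmall]] := global_lift delta0 gdelta.
(* By periodicity [F (x + n) - F x] is locally constant in [x], hence equal to its value at 0. *)
have Fper x n : n \in Z2 R -> F (x + n) = F x + F n.
  move=> nZ; rewrite [F x + _]addrC; apply/eqP; rewrite -subr_eq; apply/eqP.
  transitivity (F (0 + n) - F 0); last by rewrite add0r F0 subr0.
  apply: (@locally_constant_ray _ _ delta0 _ (fun x => F (x + n) - F x)).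
  move=> y z _ _ yz; apply: subr_swap; apply: torus_pi_inj_lt1.
    by rewrite !torus_piB !piF !gper.
  have yzn : `|(y + n) - (z + n)| < delta by rewrite opprD addrACA subrr addr0.
  have := Fsmall _ _ yz; have := Fsmall _ _ yzn; lra.
pose e j : 'rV[R]_2 := delta_mx 0 j.
have eZ j : e j \in Z2 R by apply/mxOverP => i' j'; rewrite !mxE.
have FX n k : n \in Z2 R -> F (n *+ k) = F n *+ k.
  move=> nZ; elim: k => [|k IHk]; first by rewrite !mulr0n.
  by rewrite !mulrSr Fper // IHk.
have FN n : n \in Z2 R -> F (- n) = - F n.
  by move=> nZ; apply/eqP; rewrite -addr_eq0 -Fper // addNr F0.
have FZ n k : n \in Z2 R -> F (n *~ k) = F n *~ k.
  by case: k => k nZ; rewrite ?NegzE ?mulrNz ?FN ?rpredMn // -!pmulrn FX.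
pose B : 'M[R]_2 := \matrix_j F (e j).
have FB n : n \in Z2 R -> F n = n *m B.
  move=> /mxOverP nZ.
  have /intrP[k0 n0] := nZ 0 0; have /intrP[k1 n1] := nZ 0 1.
  rewrite mulmx_sum_row !big_ord_recl big_ord0 addr0 !rowK.
  have -> : lift ord0 ord0 = 1 :> 'I_2 by apply/val_inj.
  rewrite n0 n1 !scaler_int -!FZ ?eZ // -Fper ?rpredMz ?eZ //; congr F.
  rewrite [LHS]row_sum_delta !big_ord_recl big_ord0 addr0.
  have -> : lift ord0 ord0 = 1 :> 'I_2 by apply/val_inj.
  by rewrite n0 n1 !scaler_int.
exists B.
  apply/mxOverP => i j; rewrite mxE.
  suff /mxOverP : F (e i) \in Z2 R by apply.
  by rewrite -torus_pi_eq0 piF -[e i]add0r gper ?eZ // subrr.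
(* Both [F (s *: (t *: a))] and [s *: (t *: b)], as functions of [s], lift the same path and start
   at 0. *)
have Fa t : F (t *: a) = t *: b.
  pose L := `|t *: a| + `|t *: b| + 1.
  have L0 : 0 < L by rewrite ltr_wpDl // addr_ge0.
  apply/eqP; rewrite -subr_eq0; apply/eqP.
  pose K s := F (s *: (t *: a)) - s *: (t *: b).
  transitivity (K 0); last by rewrite /K !scale0r F0 subr0.
  transitivity (K 1); first by rewrite /K !scale1r.
  (* The first bound keeps the increment of [F] below 1/4, the second that of the straight path. *)
  apply: (@locally_constant_01 _ _ K (Num.min (delta / L) (4^-1 / L))).
    by rewrite lt_min !divr_gt0 //.
  move=> s s' _ _; rewrite lt_min !ltr_pdivlMr // => /andP[sd s4].
  have Ls (u : 'rV[R]_2) : `|u| <= L -> `|s *: u - s' *: u| <= `|s - s'| * L.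
    by move=> uL; rewrite -scalerBl normrZ ler_wpM2l.
  have ta_le : `|t *: a| <= L by rewrite /L; have := normr_ge0 (t *: b); lra.
  have tb_le : `|t *: b| <= L by rewrite /L; have := normr_ge0 (t *: a); lra.
  rewrite /K; apply: subr_swap; apply: torus_pi_inj_lt1.
    rewrite torus_piB !piF /g /= opprB addrA subrK.
    have -> : s' *: (t *: a) = s *: (t *: a) + ((s' - s) * t) *: a.
      by rewrite -!scalerA -scalerDl addrC subrK.
    by rewrite torus_piD ha addrAC subrr add0r -scalerBl scalerA.
  have := Fsmall _ _ (le_lt_trans (Ls _ ta_le) sd).
  have := le_lt_trans (Ls _ tb_le) s4; rewrite distrC; lra.
(* From 0 to [x] there are [M] steps shorter than [delta], each changing [F] by less than 1/4. *)
have [C FC] : exists C, forall x, `|x| <= 1 -> `|F x| <= C.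
  pose M := (Num.truncn (1 / delta)).+1.
  exists (M%:R * (1 / 4)) => x x1; rewrite -[x]scale1r.
  apply: (@unit_interval_chain _ (fun n s => `|F (s *: x)| <= n%:R * (1 / 4)) delta).
  - by rewrite -ltr_pdivrMr //; exact: truncnS_gt.
  - by rewrite scale0r F0 normr0 mul0r.
  - move=> n s t _ _ st Fn; rewrite -(subrK (F (s *: x)) (F (t *: x))).
    have stx : `|s *: x - t *: x| < delta.
      by rewrite -scalerBl normrZ; apply: le_lt_trans st; rewrite ler_piMr.
    have := Fsmall _ _ stx; have := ler_normD (F (t *: x) - F (s *: x)) (F (s *: x)).
    rewrite -[n.+1%:R]natr1 mulrDl mul1r; lra.
apply/esym/eqP; rewrite -subr_eq0; set v := b - _.
pose C' := `|F (e 0)| + `|F (e 1)|.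
(* Split [t *: a] into a lattice part, where [F] and [B] cancel, and a remainder of norm at most
   1. *)
have tv (t : R) : `|t| * `|v| <= C + C'.
  have [n [r [tE nZ r1]]] := rV2_decomp (t *: a).
  have rB : `|r *m B| <= C'.
    rewrite mulmx_sum_row !big_ord_recl big_ord0 addr0 !rowK.
    have -> : lift ord0 ord0 = 1 :> 'I_2 by apply/val_inj.
    apply: le_trans (ler_normD _ _) _; rewrite !normrZ.
    by apply: lerD; rewrite ler_piMl // (le_trans (le_mx_norm_coord _ _) r1).
  have tvE : t *: v = F r - r *m B.
    rewrite /v scalerBr -Fa scalemxAl tE [n + r]addrC Fper // (FB n) //.
    by rewrite mulmxDl opprD addrACA subrr addr0.
  rewrite -normrZ tvE; apply: le_trans (ler_normB _ _) _.
  by apply: lerD => //; exact: FC.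
have CC0 : 0 <= C + C' by have := tv 0; rewrite normr0 mul0r.
apply: contraT => v0; have nv0 : 0 < `|v| by rewrite normr_gt0.
(* At this [t] the bound would read [C + C' + 1 <= C + C']. *)
have := tv ((C + C' + 1) / `|v|).
rewrite normrM normfV normr_id mulfVK ?gt_eqF // ger0_norm; lra.
Qed.

(** * Derivatives of torus-valued maps through local lifts *)

Lemma local_lift_shift (R : realType) (g : 'rV[R]_2 -> torus R)
    (x n : 'rV[R]_2) (F : 'rV[R]_2 -> 'rV[R]_2) :
  (forall y, g (y + n) = g y) -> local_lift g (x + n) F ->
  local_lift g x (fun y => F (y + n)).
Proof.
move=> gn [Fc Fg]; split.
  by rewrite /prop_for /continuous_at -/(F \o shift n) cvg_comp_shift.
move: Fg; rewrite (near_shift x); apply: filterS => y /=.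
by rewrite [x + n]addrC addrK gn.
Qed.

Lemma is_derive_translate (R : realType) (V W : normedModType R) (F : V -> W)
    (x v n : V) (w : W) :
  is_derive (x + n) v F w -> is_derive x v (fun y => F (y + n)) w.
Proof.
have E : (fun h : R => h^-1 *:
           (((fun y => F (y + n)) \o shift x) (h *: v) - F (x + n))) =
         (fun h : R => h^-1 *: ((F \o shift (x + n)) (h *: v) - F (x + n))).
  by apply/funext => h /=; rewrite addrA.
by move=> [dF dFw]; constructor; [rewrite /derivable E|rewrite /derive E].
Qed.

(** Near [x] the increments of both lifts from [x] are below 1/4 and project equally, so [F - G] is
    constant there. This makes [torus_derive] independent of the lift. *)
Lemma local_lift_derive_unique (R : realType) (V : normedModType R)
    (g : V -> torus R) (x v : V) (F G : V -> 'rV[R]_2) (w z : 'rV[R]_2) :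
  local_lift g x F -> local_lift g x G ->
  is_derive x v F w -> is_derive x v G z -> w = z.
Proof.
move=> [Fc Fg] [Gc Gg] dF dG.
have FGx : \forall y \near x, F y = G y + (F x - G x).
  have h4 : 0 < 1 / 4 :> R by lra.
  move/cvgrPdist_lt : Fc => /(_ _ h4) Fc; move/cvgrPdist_lt : Gc => /(_ _ h4) Gc.
  have Fgx := nbhs_singleton Fg; have Ggx := nbhs_singleton Gg.
  near=> y; apply/eqP; rewrite addrC -subr_eq; apply/eqP.
  apply: subr_swap; apply: torus_pi_inj_lt1.
    rewrite !torus_piB Fgx Ggx (near Fg y) ?(near Gg y) //.
  have : `|F x - F y| < 1 / 4 by near: y.
  have : `|G x - G y| < 1 / 4 by near: y.
  rewrite (distrC (F x)) (distrC (G x)); lra.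
have dF' : is_derive x v (fun y => G y + (F x - G x)) w by exact: near_eq_is_derive dF.
have dG' : is_derive x v (fun y => G y + (F x - G x)) z.
  have := @is_deriveD _ _ _ G (cst (F x - G x)) x v z 0 dG (is_derive_cst _ _ _).
  by rewrite addr0.
by case: dF' => _ <-; case: dG' => _ <-.
Unshelve. all: by end_near. Qed.

Lemma torus_deriveE (R : realType) (V : normedModType R)
    (g : V -> torus R) (x v : V) (F : V -> 'rV[R]_2) (w : 'rV[R]_2) :
  local_lift g x F -> is_derive x v F w -> torus_derive g x v = w.
Proof.
move=> lF dF; rewrite /torus_derive; case: xgetP => [z _ [G lG dG]|/(_ w) []].
  exact: local_lift_derive_unique lG lF dG dF.
by exists F.
Qed.

(** One lift must serve at all points near [x] for the tangent condition to be integrated along a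
    segment. *)
Lemma smooth_torus_map_lift (R : realType) (f : torus R -> torus R) (x : 'rV[R]_2) :
  smooth_torus_map f ->
  exists F : 'rV[R]_2 -> 'rV[R]_2, [/\ local_lift (f \o @torus_pi R) x F &
    \forall y \near x, local_lift (f \o @torus_pi R) y F /\ differentiable F y].
Proof.
move=> /(_ x)[F lF [U [oU Ux FU]]]; exists F; split => //.
case: lF => _; rewrite /prop_near1 nbhsE => -[N [oN Nx] NF].
exists (U `&` N); first by split; [exact: openI|].
move=> y [Uy Ny].
split; last by case: (FU 1%N) => /(_ y Uy).
split; first exact: FU 0%N y Uy.
exact: filterS NF (open_nbhs_nbhs (conj oN Ny)).
Qed.

(** [tangent_map] is computed at the representative chosen by [repr]; translation by the lattice
    vector [n] carries the computation to [x]. *)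
Lemma tangent_map_lift (R : realType) (f : torus R -> torus R)
    (x v : 'rV[R]_2) (F : 'rV[R]_2 -> 'rV[R]_2) :
  local_lift (f \o @torus_pi R) x F -> differentiable F x ->
  is_derive x v F (tangent_map f (torus_pi x) v).
Proof.
move=> lF dF; pose y := repr (torus_pi x); pose n := x - y.
have yn : y + n = x by rewrite /n addrC subrK.
have dFv : is_derive x v F ('D_v F x) by exact/derivableP/diff_derivable.
suff -> : tangent_map f (torus_pi x) v = 'D_v F x by [].
apply: (@torus_deriveE _ _ _ y v (fun z => F (z + n))).
  apply: local_lift_shift; rewrite ?yn // => z /=.
  rewrite torus_piD [torus_pi n](_ : _ = 0) ?addr0 //.
  by rewrite torus_piB torus_piK subrr.
by apply: is_derive_translate; rewrite yn.
Qed.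

Lemma is_derive_line_coord (R : realType) (F : 'rV[R]_2 -> 'rV[R]_2)
    (x v w : 'rV[R]_2) (s : R) j :
  is_derive (x + s *: v) v F w ->
  is_derive s 1 (fun s => F (x + s *: v) 0 j) (w 0 j).
Proof.
move=> [dF <-].
pose phi (s : R) : R := F (x + s *: v) 0 j.
have E : (fun h : R => h^-1 *: ((phi \o shift s) (h *: 1) - phi s)) =
    (fun h : R => (h^-1 *: ((F \o shift (x + s *: v)) (h *: v) -
                            F (x + s *: v))) 0 j).
  apply/funext => h /=; rewrite /phi !mxE; congr (_ * (F _ _ _ - _)).
  by rewrite [h *: 1]mulr1 scalerDl addrCA.
have H : (fun h : R => h^-1 *: ((phi \o shift s) (h *: 1) - phi s)) @ 0^' -->
    ('D_v F (x + s *: v)) 0 j.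
  rewrite E; apply: (@cvg_comp _ _ _ _ (fun M : 'rV[R]_2 => M 0 j) _ _ _ dF).
  exact: coord_continuous.
by constructor; [exact: cvgP H|exact: cvg_lim H].
Qed.

(** * Integration of the tangent condition *)

Lemma zero_derive_cst_near (R : realType) (phi : R -> R) (eta : R) :
  (forall s : R, `|s| < eta -> is_derive s 1 phi 0) ->
  forall s : R, `|s| < eta -> phi s = phi 0.
Proof.
move=> dphi.
suff mono u w : u <= w -> `|u| < eta -> `|w| < eta -> phi w = phi u.
  move=> s seta; have eta0 : `|0 : R| < eta by rewrite normr0; apply: le_lt_trans seta.
  by case: (lerP 0 s) => s0; [exact: mono|apply/esym; apply: mono => //; exact: ltW].
rewrite !ltr_norml => uw /andP[ueta _] /andP[_ weta].
have in_eta z : u <= z <= w -> `|z| < eta.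
  by case/andP=> uz zw; rewrite ltr_norml (lt_le_trans ueta uz) (le_lt_trans zw weta).
have [||c _] := @MVT_segment R phi (cst 0) u w uw.
- move=> z; rewrite in_itv /= => /andP[uz zw].
  by apply/dphi/in_eta; rewrite !ltW.
- apply: continuous_in_subspaceT => z; rewrite inE /= in_itv /= => zuw.
  apply: differentiable_continuous; apply/derivable1_diffP.
  by case: (dphi z (in_eta _ zuw)).
by rewrite mul0r => /eqP; rewrite subr_eq0 => /eqP.
Qed.

(** The set where [K] equals [K 0] and its complement are both open, and the line is connected. *)
Lemma locally_constant_line (R : realType) (T : Type) (K : R -> T) :
  (forall t, \forall s \near t, K s = K t) -> forall t, K t = K 0.
Proof.
move=> Kl.
have cR : connected [set: R] by apply/connected_intervalP.
have op (P : T -> Prop) : open [set t | P (K t)].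
  by rewrite openE => t /= Pt; apply: filterS (Kl t) => s /= ->.
suff E : [set t | K t = K 0] = [set: R] by move=> t; have : [set: R] t by []; rewrite -E.
apply: cR; first by exists 0.
- by exists [set t | K t = K 0]; [exact: (op (fun k => k = K 0))|rewrite setTI].
- exists [set t | K t = K 0]; last by rewrite setTI.
  by rewrite -openC; exact: (op (fun k => k <> K 0)).
Qed.

(** A local lift has constant derivative [b] in the direction [a], so it is affine on short
    segments, and [K] below is locally constant. *)
Lemma constant_tangent_equivariant (R : realType) (f : torus R -> torus R)
    (a b : 'rV[R]_2) :
  smooth_torus_map f -> (forall p, tangent_map f p a = b) ->
  forall p t, f (p + torus_pi (t *: a)) = f p + torus_pi (t *: b).
Proof.
move=> fS fab p t; pose x := repr p.
pose K s := f (torus_pi (x + s *: a)) - torus_pi (s *: b).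
suff : K t = K 0.
  move/eqP; rewrite /K !scale0r addr0 [torus_pi 0](raddf0 _) subr0 subr_eq => /eqP.
  by rewrite torus_piD torus_piK.
apply: locally_constant_line => {}t; pose y := x + t *: a.
have [F [[_ Fg] Fd]] := smooth_torus_map_lift y fS.
have /nbhs_normP[r /= r0 Fr] :
    \forall z \near y, torus_pi (F z) = f (torus_pi z) /\ is_derive z a F b.
  near=> z; split; first by near: z.
  have [lF dF] : local_lift (f \o @torus_pi R) z F /\ differentiable F z by near: z.
  by rewrite -(fab (torus_pi z)); exact: tangent_map_lift.
pose eta := r / (`|a| + 1).
have a1 : 0 < `|a| + 1 by rewrite ltr_wpDl.
have near_y s : `|s| < eta -> `|y - (y + s *: a)| < r.
  rewrite /eta ltr_pdivlMr // opprD addrA subrr add0r normrN normrZ.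
  by apply: le_lt_trans; rewrite ler_wpM2l // lerDl.
have Fline s : `|s| < eta -> F (y + s *: a) = F y + s *: b.
  move=> seta; apply/rowP => j.
  (* Subtracting the expected linear term leaves a function of zero derivative. *)
  have := @zero_derive_cst_near R (fun s => F (y + s *: a) 0 j - b 0 j * s) eta.
  move=> /(_ _ s seta); rewrite scale0r addr0 mulr0 subr0 !mxE mulrC => H.
  apply/eqP; rewrite -subr_eq; apply/eqP; apply: H => u ueta.
  have [_ dF] := Fr _ (near_y _ ueta).
  have d1 := is_derive_line_coord j dF.
  have d2 : is_derive u 1 (fun s : R => b 0 j * s) (b 0 j).
    by have := is_deriveZ (b 0 j) (is_derive_id u (1 : R)); rewrite [_ *: 1]mulr1.
  by have := is_deriveB d1 d2; rewrite subrr.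
have eta0 : 0 < eta by rewrite divr_gt0.
near=> s; have ts : `|s - t| < eta by rewrite distrC; near: s; apply/nbhs_normP; exists eta.
have sE : s = t + (s - t) by rewrite addrC subrK.
rewrite /K sE scalerDl addrA -/y.
have [<- _] := Fr _ (near_y _ ts).
have <- : torus_pi (F y) = f (torus_pi y) by exact: (nbhs_singleton Fg).
rewrite Fline // torus_piD -addrA; congr (_ + _).
by rewrite -sE scalerBl torus_piB addrAC subrr add0r.
Unshelve. all: by end_near. Qed.

(** * Quadratic fields and integer eigenvectors *)

(** The quadratic relation closes the rational span of 1 and [x] under products; independence makes
    the norm of a nonzero element nonzero, which gives inverses. *)
Lemma quadratic_span_field (R : realType) (x : R) (p q : rat) :
  rationally_independent 1 x -> x ^+ 2 = ratr p * x + ratr q ->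
  exists F : {pred R}, real_quadratic_field F /\ rational_basis F 1 x.
Proof.
move=> x_indep x2.
pose F : {pred R} :=
  [pred y | `[< exists r s : rat, y = ratr r * 1 + ratr s * x >]].
have FP y : reflect (exists r s : rat, y = ratr r * 1 + ratr s * x) (y \in F).
  exact: asboolP.
have F_basis : rational_basis F 1 x.
  split=> //; [| |by move=> y /FP].
  - by apply/FP; exists 1, 0; rewrite rmorph1 rmorph0 mul0r mulr1 addr0.
  - by apply/FP; exists 0, 1; rewrite rmorph1 rmorph0 mul0r mul1r add0r.
exists F; split=> //; split; last by exists 1, x.
have [F1 _ _ _] := F_basis.
have Fdiv y : y \in F -> y != 0 -> y^-1 \in F.
  move=> /FP[r [s ->]] y0.
  (* the norm of [r + s x], whose conjugate is [r + s p - s x] *)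
  pose N := r ^+ 2 + r * s * p - s ^+ 2 * q.
  have NE : ratr N = (ratr r * 1 + ratr s * x) *
                     (ratr (r + s * p) * 1 + ratr (- s) * x) :> R.
    rewrite /N !(rmorphB, rmorphD, rmorphN, rmorphXn, rmorphM) /=.
    have -> : ratr q = x ^+ 2 - ratr p * x by rewrite x2 addrC addKr.
    by ring.
  have N0 : ratr N != 0 :> R.
    rewrite NE mulf_neq0 //; apply: contra_neq y0 => /x_indep[rsp /eqP].
    rewrite oppr_eq0 => /eqP s0; move: rsp; rewrite s0 mul0r addr0 => ->.
    by rewrite rmorph0 !mul0r addr0.
  apply/FP; exists ((r + s * p) / N), (- s / N).
  apply: (mulfI y0); rewrite divff // !fmorph_div /=.
  rewrite -[LHS](divff N0) [X in X / _ = _]NE; ring.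
split=> // y z.
  move=> /FP[r [s ->]] /FP[r' [s' ->]]; apply/FP; exists (r - r'), (s - s').
  by rewrite !rmorphB; ring.
(* Closure under division includes [z = 0], whose inverse is 0 by convention. *)
move=> Fy Fz; have [->|z0] := eqVneq z 0.
  by rewrite invr0 mulr0; apply/FP; exists 0, 0; rewrite rmorph0 !mul0r addr0.
move: Fy (Fdiv z Fz z0) => /FP[r [s ->]] /FP[r' [s' ->]]; apply/FP.
(* Coefficients of the product once [x ^+ 2] is replaced by [ratr p * x + ratr q]. *)
exists (r * r' + s * s' * q), (r * s' + s * r' + s * s' * p).
rewrite !(rmorphD, rmorphM) /=.
have -> : ratr q = x ^+ 2 - ratr p * x by rewrite x2 addrC addKr.
by ring.
Qed.

(** With [x = a 0 1 / a 0 0] the equation reads [alpha = B 0 0 + x * B 1 0] and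
    [alpha * x = B 0 1 + x * B 1 1]. Either [B 1 0 = 0] and [alpha] is an integer, or eliminating
    [alpha] gives a rational quadratic equation for [x]. *)
Lemma integer_matrix_eigenvector (R : realType) (a : 'rV[R]_2) (alpha : R)
    (B : 'M[R]_2) :
  rationally_independent (a 0 0) (a 0 1) ->
  B \is a mxOver Num.int -> a *m B = alpha *: a ->
  alpha \is a Num.int \/
  exists F : {pred R}, real_quadratic_field F /\
    exists2 theta, theta != 0 & rational_basis F (theta * a 0 0) (theta * a 0 1).
Proof.
move=> a_indep /mxOverP Bint aB.
have a00 : a 0 0 != 0.
  apply/eqP => a0; have [|/eqP] := a_indep 1 0; last by rewrite oner_eq0.
  by rewrite a0 mulr0 rmorph0 mul0r addr0.
pose x := a 0 1 / a 0 0.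
have aE : a 0 1 = x * a 0 0 by rewrite /x mulfVK.
have coord j : B 0 j + x * B 1 j = alpha * (a 0 j / a 0 0).
  have /(congr1 (fun M : 'rV_2 => M 0 j / a 0 0)) := aB.
  rewrite !mxE !big_ord_recl big_ord0 addr0.
  have -> : lift ord0 ord0 = 1 :> 'I_2 by apply/val_inj.
  by rewrite -mulrA => <-; rewrite aE; field.
have := coord 0; rewrite divff // mulr1; have := coord 1; rewrite -/x => e1 e0.
have [B10|B10] := eqVneq (B 1 0) 0.
  by left; rewrite -e0 B10 mulr0 addr0.
right.
have /intrP[m00 h00] := Bint 0 0; have /intrP[m01 h01] := Bint 0 1.
have /intrP[m10 h10] := Bint 1 0; have /intrP[m11 h11] := Bint 1 1.
have x_indep : rationally_independent 1 x.
  move=> r s; rewrite mulr1 => rs; apply: a_indep.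
  by rewrite aE mulrA -mulrDl rs mul0r.
have x2 : x ^+ 2 = ratr ((m11 - m00)%:~R / m10%:~R) * x + ratr (m01%:~R / m10%:~R).
  rewrite !fmorph_div /= !ratr_int rmorphB /= -h00 -h01 -h10 -h11.
  apply: (mulfI B10).
  transitivity (B 0 1 + x * B 1 1 - B 0 0 * x); last by field.
  by rewrite e1 -e0; ring.
have [F [Fq Fb]] := quadratic_span_field x_indep x2.
exists F; split => //; exists (a 0 0)^-1; first by rewrite invr_eq0.
by rewrite mulVf // mulrC.
Qed.

Lemma int_unit_pm1 (R : realType) (x : R) :
  x != 0 -> x \is a Num.int -> x^-1 \is a Num.int -> x = 1 \/ x = -1.
Proof.
move=> x0 xZ xVZ.
have := norm_intr_ge1 xVZ; rewrite invr_eq0 => /(_ x0).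
rewrite normfV invf_ge1 ?normr_gt0 // => x1.
have /eqP : `|x| = 1 by apply/eqP; rewrite eq_le x1 norm_intr_ge1.
by rewrite eqr_norml => /andP[/orP[]/eqP ->]; [left|right].
Qed.

(** * Multipliers of a flow generated by a constant field *)

Lemma Ck_scale (R : realType) (V : normedModType R) n (U : set V) (c : R) :
  Ck n U (fun x : V => c *: x).
Proof.
have Ck_cst m (w : V) : Ck m U (cst w : V -> V).
  elim: m w => [|m IHm] w /=; first by move=> x _; exact: cst_continuous.
  split=> [x _|v]; first exact: differentiable_cst.
  rewrite (_ : 'D_v _ = cst 0) //; apply/funext => x; exact: derive_cst.
case: n => [|n] /=; first by move=> x _; exact: scaler_continuous.
split=> [x _|v]; first exact: differentiableZ.
rewrite (_ : 'D_v _ = cst (c *: v)) //; apply/funext => x.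
by case: (is_deriveZ c (is_derive_id x v)).
Qed.

Lemma multiplier_tangent (R : realType) (psi : R -> torus R -> torus R)
    (a : 'rV[R]_2) (f : diffeo R) (alpha : R) :
  generated_by_constant psi a ->
  is_multiplier psi f alpha <->
  alpha != 0 /\ forall p, tangent_map f p a = alpha *: a.
Proof.
move=> psia; split=> -[alpha0 fa]; split=> // p.
  by have := fa (f p); rewrite /Defs.pushforward !psia dfunK.
by rewrite /Defs.pushforward !psia.
Qed.

Lemma multiplierE (R : realType) (psi : R -> torus R -> torus R)
    (a : 'rV[R]_2) (f : diffeo R) (alpha : R) :
  generated_by_constant psi a -> a != 0 -> is_multiplier psi f alpha ->
  multiplier psi f = alpha.
Proof.
move=> psia a0 fa; rewrite /multiplier.
case: xgetP => [beta _ /(multiplier_tangent _ _ psia)[_ fb]|/(_ alpha)]; last by case.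
have [_ {}fa] := (multiplier_tangent _ _ psia).1 fa.
have /eqP := fb 0; rewrite fa -subr_eq0 -scalerBl scaler_eq0 (negPf a0) orbF.
by rewrite subr_eq0 => /eqP.
Qed.

Lemma multiplier_matrices (R : realType) (psi : R -> torus R -> torus R)
    (a : 'rV[R]_2) (f : diffeo R) (alpha : R) :
  generated_by_constant psi a -> is_multiplier psi f alpha ->
  (exists2 B : 'M[R]_2, B \is a mxOver Num.int & a *m B = alpha *: a) /\
  (exists2 B : 'M[R]_2, B \is a mxOver Num.int & a *m B = alpha^-1 *: a).
Proof.
move=> psia /(multiplier_tangent _ _ psia)[alpha0 fa].
have feq := constant_tangent_equivariant (@dfun_smooth _ f) fa.
have lift g : smooth_torus_map g -> forall x, exists F, local_lift (g \o @torus_pi R) x F.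
  by move=> gS x; have [F []] := smooth_torus_map_lift x gS; exists F.
split; first exact: equivariant_map_matrix (lift _ (@dfun_smooth _ f)) feq.
(* The equivariance of the inverse follows from that of [f]: both sides have the same image under
   [f]. *)
apply: equivariant_map_matrix (lift _ (@dinv_smooth _ f)) _ => p t.
apply: (can_inj (@dfunK _ f)); rewrite dinvK !scalerA feq dinvK.
by rewrite scalerA divfK.
Qed.

(** Serves for [c = 1] and [c = -1], realised by the identity and by negation. As [f] is an
    involution, it is also the inverse in the diffeomorphism. *)
Lemma scale_multiplier (R : realType) (psi : R -> torus R -> torus R)
    (a : 'rV[R]_2) (c : R) (f : torus R -> torus R) :
  generated_by_constant psi a -> a != 0 -> c != 0 -> involutive f ->
  (forall x, f (torus_pi x) = torus_pi (c *: x)) ->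
  multiplier_group psi c.
Proof.
move=> psia a0 c0 fK fpi.
have lf (x : 'rV[R]_2) : local_lift (f \o @torus_pi R) x (fun y => c *: y).
  by split; [exact: scaler_continuous|near=> y; rewrite /= fpi].
have fS : smooth_torus_map f.
  move=> x; exists (fun y => c *: y); first exact: lf.
  by exists setT; split=> [|//|n]; [exact: openT|exact: Ck_scale].
have fc : is_multiplier psi (Diffeo fK fK fS fS) c.
  apply/(multiplier_tangent _ _ psia); split=> // p.
  by apply: torus_deriveE (lf _) _; exact: is_deriveZ.
by exists (Diffeo fK fK fS fS); [exists c|exact: multiplierE fc].
Unshelve. all: by end_near. Qed.

Theorem theorem4p5 (R : realType) (psi : R -> torus R -> torus R) :
  quasiperiodic_flow psi -> transcendental_flow psi ->
  multiplier_group psi = [set 1; -1].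
Proof.
move=> qpsi [_ psiT]; have [_ [a [psia a_indep]]] := qpsi.
have a0 : a != 0.
  apply/eqP => a0; have [|/eqP] := a_indep 1 0; last by rewrite oner_eq0.
  by rewrite a0 !mxE !mulr0 addr0.
(* Transcendence excludes the quadratic alternative. *)
have int_eigen (B : 'M[R]_2) beta : B \is a mxOver Num.int -> a *m B = beta *: a ->
    beta \is a Num.int.
  move=> Bint aB; have [//|[F [Fq Fb]]] := integer_matrix_eigenvector a_indep Bint aB.
  by case: (psiT F Fq); split=> //; exists a.
apply/seteqP; split=> [beta [f [alpha fa] <-]|beta /= [->|->]].
- rewrite (multiplierE psia a0 fa); have [alpha0 _] := fa.
  have [[B Bint aB] [B' B'int aB']] := multiplier_matrices psia fa.
  have := int_unit_pm1 alpha0 (int_eigen _ _ Bint aB) (int_eigen _ _ B'int aB').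
  by case=> ->; [left|right].
- apply: (scale_multiplier (f := id)) psia a0 _ _ _ => // x.
  by rewrite scale1r.
- apply: (scale_multiplier (f := -%R)) psia a0 _ _ _; first by rewrite oppr_eq0 oner_neq0.
    exact: opprK.
  by move=> x; rewrite scaleN1r torus_piN.
Qed.
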